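(* Assume that $\rho(x)$, $x\in\mathbf U_{x_0,h}$, is a non-negative function. Then the unique weights which minimize $g_\rho(w)$ subject to the constraints $w(x)\ge 0$ for all $x\in\mathbf U_{x_0,h}$ and $\sum_{x\in\mathbf U_{x_0,h}}w(x)=1$ are given by $$w_\rho(x)=\frac{K_{\mathrm{tr}}\left(\frac{\rho(x)}{a}\right)}{\sum_{y\in\mathbf U_{x_0,h}}K_{\mathrm{tr}}\left(\frac{\rho(y)}{a}\right)},\qquad x\in\mathbf U_{x_0,h},$$ where the bandwidth $a>0$ is the unique solution on $(0,\infty)$ of the equation $$M_\rho(a)=\sigma^2 .$$
   Context: For a positive integer $N$, $\mathbf I=\{\frac1N,\frac2N,\dots,\frac{N-1}N,1\}^2$. For $x_0\in\mathbf I$ and $h>0$ (with $h$ a multiple of $1/N$, i.e. $h=k/N$ for some $k\in\{1,\dots,N\}$), $\mathbf U_{x_0,h}=\{x\in\mathbf I:\|x-x_0\|_\infty\le h\}$, where $\|\cdot\|_\infty$ is the supremum norm on $\mathbb R^2$. Let $\sigma>0$ and write $t^+=\max(t,0)$. For a non-negative function $\rho$ on $\mathbf U_{x_0,h}$ and $w=(w(x))_{x\in\mathbf U_{x_0,h}}$ define $$g_\rho(w)=\Big(\sum_{x\in\mathbf U_{x_0,h}}w(x)\rho(x)\Big)^2+\sigma^2\sum_{x\in\mathbf U_{x_0,h}}w(x)^2,$$ $$M_\rho(t)=\sum_{x\in\mathbf U_{x_0,h}}\rho(x)\,(t-\rho(x))^+,\quad t\ge0.$$ The triangular kernel is $K_{\mathrm{tr}}(t)=(1-|t|)^+$,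 $t\in\mathbb R$.
   Formalization: The function ρ is additionally assumed not identically zero: for ρ = 0 one has M_ρ = 0, so the equation M_ρ(a) = σ² > 0 has no solution and the bandwidth a does not exist. *)

(* Defs.v *)
From HB Require Import structures.
From mathcomp Require Import all_boot all_order all_algebra.
From mathcomp Require Import finmap.
From mathcomp Require Import all_classical all_reals all_analysis.
Import Order.TTheory GRing.Theory Num.Theory.
Import numFieldNormedType.Exports.

Set Implicit Arguments.
Unset Strict Implicit.
Unset Printing Implicit Defensive.

Local Open Scope fset_scope.
Local Open Scope ring_scope.

Definition pospart (R : realType) (t : R) : R := Num.max t 0.

Definition Ktr (R : realType) (t : R) : R := pospart (1 - `|t|).

Definition grid (R : realType) (N : nat) : {fset (R * R)%type} :=
  [fset (i%:R / N%:R, j%:R / N%:R) | i in iota 1 N, j in iota 1 N].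

(* The norm of the product [R * R] is the supremum norm; see [window_normE]. *)
Definition window (R : realType) (N : nat) (x0 : R * R) (h : R) :
    {fset (R * R)%type} :=
  [fset x in grid R N | `|x - x0| <= h].

Lemma window_normE (R : realType) (x : R * R) :
  `|x| = Num.max `|x.1| `|x.2|.
Proof. by []. Qed.

(* Functions on [window N x0 h] are functions on the finite type attached to
   this finite set, so the index type is left abstract below. *)
Definition g (R : realType) (T : finType) (sigma : R) (rho : T -> R)
    (w : {ffun T -> R}) : R :=
  (\sum_x w x * rho x) ^+ 2 + sigma ^+ 2 * \sum_x w x ^+ 2.

Definition M (R : realType) (T : finType) (rho : T -> R) (t : R) : R :=
  \sum_x rho x * pospart (t - rho x).

Definition admissible (R : realType) (T : finType) (w : {ffun T -> R}) : Prop :=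
  (forall x, 0 <= w x) /\ \sum_x w x = 1.

Definition minimizes_g (R : realType) (T : finType) (sigma : R) (rho : T -> R)
    (w : {ffun T -> R}) : Prop :=
  admissible w /\ forall v, admissible v -> g sigma rho w <= g sigma rho v.

Definition wtr (R : realType) (T : finType) (rho : T -> R) (a : R) :
    {ffun T -> R} :=
  [ffun x => Ktr (rho x / a) / \sum_y Ktr (rho y / a)].

(* Main.v *)
(* Writing [S] for the sum of the [(a - rho y)^+], the weights of [wtr rho a]
   are [(a - rho x)^+ / S], and [M rho a = sigma ^+ 2] says that their mean of
   [rho] is [sigma ^+ 2 / S].  Hence half the gradient of [g] at these weights
   has entries [(sigma ^+ 2 / S) * max (a, rho x)]: it is constant where the
   weights are positive and at least as large elsewhere.  As [g] is
   [sigma ^+ 2]-strongly convex, these KKT conditions give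
   [g v >= g w + sigma ^+ 2 * \sum_x (v x - w x) ^+ 2] for admissible [v],
   which yields both optimality and uniqueness. *)
Require Import Defs.
From mathcomp Require Import all_boot all_order all_algebra.
From mathcomp Require Import finmap.
From mathcomp Require Import all_classical all_reals all_analysis.
From mathcomp Require Import ring lra.
Import Order.TTheory GRing.Theory Num.Theory.
Import numFieldNormedType.Exports.

Set Implicit Arguments.
Unset Strict Implicit.
Unset Printing Implicit Defensive.

Local Open Scope ring_scope.

Lemma pospart_ge0 (R : realType) (t : R) : 0 <= pospart t.
Proof. by rewrite /pospart le_max lexx orbT. Qed.

Lemma pospart_ge (R : realType) (t : R) : t <= pospart t.
Proof. by rewrite /pospart le_max lexx. Qed.

Lemma le_pospart (R : realType) (s t : R) : s <= t -> pospart s <= pospart t.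
Proof. by move=> st; rewrite /pospart !maxEle; do 2 case: ifP; lra. Qed.

Lemma pospart_gt0 (R : realType) (t : R) : (0 < pospart t) = (0 < t).
Proof. by rewrite /pospart lt_max ltxx orbF. Qed.

Lemma gt0_pospart (R : realType) (t : R) : 0 < t -> pospart t = t.
Proof. by move=> t0; rewrite /pospart max_l // ltW. Qed.

Lemma pospartB (R : realType) (t : R) : pospart t - pospart (- t) = t.
Proof. by rewrite /pospart !maxEle; do 2 case: ifP; lra. Qed.

Lemma pospart_mulN (R : realType) (t : R) : pospart t * pospart (- t) = 0.
Proof. by rewrite /pospart !maxEle; do 2 case: ifP; nra. Qed.

(** Since [0 <= r / a], the absolute value disappears and [1 / a] factors out of the positive part;
    it cancels once the weights are normalized. *)
Lemma Ktr_div (R : realType) (a r : R) :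
  0 < a -> 0 <= r -> Ktr (r / a) = pospart (a - r) / a.
Proof.
move=> a0 r0; rewrite /Ktr /pospart ger0_norm; last by rewrite divr_ge0 // ltW.
by rewrite -[1](divff (lt0r_neq0 a0)) -mulrBl maxr_pMl ?mul0r // invr_ge0 ltW.
Qed.

Lemma M0 (R : realType) (T : finType) (rho : T -> R) :
  (forall x, 0 <= rho x) -> M rho 0 = 0.
Proof.
move=> rho0; rewrite /M big1 // => x _.
by rewrite /pospart sub0r max_r ?mulr0 // oppr_le0.
Qed.

Lemma M_continuous (R : realType) (T : finType) (rho : T -> R) :
  continuous (M rho).
Proof.
apply: (@continuous_big _ _ +%R 0 xpredT) => [|x _]; first exact: add_continuous.
move=> t; apply: cvgM; first exact: cvg_cst.
apply: (@continuous_max _ _ (fun t : R => t - rho x) (fun=> 0)).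
  by apply: cvgB; [exact: cvg_id|exact: cvg_cst].
exact: cvg_cst.
Qed.

Lemma M_gt0_term (R : realType) (T : finType) (rho : T -> R) (t : R) :
  (forall x, 0 <= rho x) -> 0 < M rho t -> exists2 x, 0 < rho x & rho x < t.
Proof.
move=> rho0 Mt0.
have [x _ /=] : exists2 x, x \in T & 0 < rho x * pospart (t - rho x).
  apply: contrapT => H; suff : M rho t <= 0 by rewrite leNgt Mt0.
  by apply: sumr_le0 => x _; rewrite leNgt; apply/negP => h; apply: H; exists x.
move=> xt0; have rx : 0 < rho x.
  by rewrite lt_neqAle rho0 andbT eq_sym; apply: contraTneq xt0 => ->;
     rewrite mul0r ltxx.
by exists x => //; move: xt0; rewrite pmulr_rgt0 // pospart_gt0 subr_gt0.
Qed.

(** [M rho] vanishes up to the least positive value of [rho], hence the condition [0 < M rho s]: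
    some term positive at [s] grows strictly, and the others do not decrease. *)
Lemma M_lt (R : realType) (T : finType) (rho : T -> R) (s t : R) :
  (forall x, 0 <= rho x) -> 0 < M rho s -> s < t -> M rho s < M rho t.
Proof.
move=> rho0 /(M_gt0_term rho0)[x rx xs] st.
rewrite /M (bigD1 x) //= [ltRHS](bigD1 x) //=; apply: ltr_leD.
  by rewrite ltr_pM2l // !gt0_pospart; lra.
by apply: ler_sum => y _; rewrite ler_wpM2l // le_pospart //; lra.
Qed.

Lemma M_eq_uniq (R : realType) (T : finType) (rho : T -> R) (c s t : R) :
  (forall x, 0 <= rho x) -> 0 < c -> M rho s = c -> M rho t = c -> s = t.
Proof.
move=> rho0 c0 Ms Mt; case: (ltgtP s t) => // st;
  by have := M_lt rho0 _ st; rewrite Ms Mt ltxx => /(_ c0).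
Qed.

(** Intermediate value theorem on [[0, b]]; a nonzero value of [rho] keeps [M rho] from vanishing
    identically. *)
Lemma M_eq_exists (R : realType) (T : finType) (rho : T -> R) (c : R) :
  (forall x, 0 <= rho x) -> (exists x, rho x <> 0) -> 0 < c ->
  exists2 a, 0 < a & M rho a = c.
Proof.
move=> rho0 [x /eqP rx0] c0.
have rx : 0 < rho x by rewrite lt_neqAle eq_sym rx0 rho0.
(* Chosen so that the term of [M rho b] at [x] alone equals [c]. *)
pose b := rho x + c / rho x.
have b0 : 0 <= b by rewrite addr_ge0 // divr_ge0 // ltW.
have cMb : c <= M rho b.
  rewrite /M (bigD1 x) //= -[leLHS]addr0 lerD //; last first.
    by apply: sumr_ge0 => y _; rewrite mulr_ge0 // pospart_ge0.
  rewrite -[leLHS](mulfVK rx0) mulrC ler_pM2l //.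
  by apply: le_trans (pospart_ge _); rewrite /b addrAC subrr add0r.
have [||a] := @IVT R (M rho) 0 b c b0.
- exact/continuous_subspaceT/M_continuous.
- by rewrite M0 // ge_min le_max cMb ltW //= orbT.
rewrite in_itv /= => /andP[a0 _] Ma; exists a => //.
(* The interval only gives [0 <= a]; [a = 0] would force [c = M rho 0 = 0]. *)
rewrite lt_neqAle a0 andbT; apply: contraTneq c0 => a00.
by rewrite -Ma -a00 M0 // ltxx.
Qed.

Section TriangularWeights.
Context (R : realType) (T : finType) (sigma : R) (rho : T -> R) (a : R).
Hypotheses (rho0 : forall x, 0 <= rho x) (sigma0 : 0 < sigma).
Hypotheses (a0 : 0 < a) (Ma : M rho a = sigma ^+ 2).

Let S := \sum_y pospart (a - rho y).
Let lam := sigma ^+ 2 / S.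

(** [M rho a] is positive, so some [x] has [rho x < a] and contributes a positive term. *)
Let S_gt0 : 0 < S.
Proof.
have [||x _ xa] := @M_gt0_term R T rho a => //; first by rewrite Ma exprn_gt0.
rewrite /S (bigD1 x) //= ltr_pwDl ?pospart_gt0 ?subr_gt0 //.
by apply: sumr_ge0 => y _; exact: pospart_ge0.
Qed.

Lemma wtrE x : wtr rho a x = pospart (a - rho x) / S.
Proof.
rewrite ffunE (eq_bigr (fun y => pospart (a - rho y) / a)) => [|y _]; last first.
  exact: Ktr_div.
rewrite Ktr_div // -mulr_suml -/S.
by field; rewrite !gt_eqF.
Qed.

Lemma wtr_admissible : admissible (wtr rho a).
Proof.
split=> [x|]; first by rewrite wtrE divr_ge0 ?pospart_ge0 // ltW.
by under eq_bigr do rewrite wtrE; rewrite -mulr_suml divff // gt_eqF.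
Qed.

Lemma wtr_mean : \sum_x wtr rho a x * rho x = lam.
Proof.
rewrite /lam -Ma /M mulr_suml; apply: eq_bigr => x _.
by rewrite wtrE; ring.
Qed.

(** [a + pospart (rho x - a)] is the maximum of [a] and [rho x]; this form isolates
    [lam * pospart (rho x - a)], half the KKT multiplier of the sign constraint at [x]. *)
Lemma wtr_stationary x :
  lam * rho x + sigma ^+ 2 * wtr rho a x = lam * (a + pospart (rho x - a)).
Proof.
rewrite wtrE /lam -[pospart (rho x - a)](subKr (pospart (a - rho x))).
by rewrite -[rho x - a]opprB pospartB; field; rewrite gt_eqF.
Qed.

(** Stationarity averaged against [v]. It is applied both to a competitor and to [wtr rho a]
    itself. *)
Lemma wtr_pairing (v : {ffun T -> R}) : \sum_x v x = 1 ->
  lam * \sum_x v x * rho x + sigma ^+ 2 * \sum_x v x * wtr rho a x =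
  lam * a + lam * \sum_x v x * pospart (rho x - a).
Proof.
move=> v1; rewrite -[X in lam * X + lam * _]mul1r -v1 mulr_suml !mulr_sumr.
rewrite -!big_split /=; apply: eq_bigr => x _.
transitivity (v x * (lam * rho x + sigma ^+ 2 * wtr rho a x)); first by ring.
by rewrite wtr_stationary; ring.
Qed.

Lemma g_wtr_gap (v : {ffun T -> R}) : admissible v ->
  g sigma rho (wtr rho a) + sigma ^+ 2 * \sum_x (v x - wtr rho a x) ^+ 2
    <= g sigma rho v.
Proof.
move=> [v0 v1].
have lam_ge0 : 0 <= lam by rewrite divr_ge0 // ltW // exprn_gt0.
have slack_v : 0 <= lam * \sum_x v x * pospart (rho x - a).
  by rewrite mulr_ge0 // sumr_ge0 // => x _; rewrite mulr_ge0 // pospart_ge0.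
(* Complementary slackness: at each [x] either the weight or the excess of [rho x] over [a] is
   zero. *)
have slack_w : \sum_x wtr rho a x * pospart (rho x - a) = 0.
  rewrite big1 // => x _.
  by rewrite wtrE -[rho x - a]opprB mulrAC pospart_mulN mul0r.
have Pv := wtr_pairing v1.
have := wtr_pairing wtr_admissible.2; rewrite wtr_mean slack_w => Pw.
have -> : \sum_x (v x - wtr rho a x) ^+ 2 = \sum_x v x ^+ 2
    - 2 * (\sum_x v x * wtr rho a x) + \sum_x wtr rho a x * wtr rho a x.
  rewrite mulr_sumr -sumrB -big_split /=; apply: eq_bigr => x _.
  by ring.
rewrite /g wtr_mean; under [X in _ + _ * X + _]eq_bigr do rewrite expr2.
(* By [Pv] and [Pw], the right side minus the left side is exactly this square plus twice the
   quantity in [slack_v]. *)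
have := sqr_ge0 (\sum_x v x * rho x - lam).
by nra.
Qed.

Lemma wtr_unique_minimizer : unique (minimizes_g sigma rho) (wtr rho a).
Proof.
split=> [|v [adm_v v_min]].
  split=> [|v /g_wtr_gap]; first exact: wtr_admissible.
  apply: le_trans; rewrite lerDl mulr_ge0 ?sqr_ge0 //.
  by apply: sumr_ge0 => x _; exact: sqr_ge0.
(* Minimality of [v] leaves no room for the quadratic gap, so the squared distance from [v] to
   [wtr rho a] is zero. *)
have := le_trans (g_wtr_gap adm_v) (v_min _ wtr_admissible).
rewrite gerDl pmulr_rle0 ?exprn_gt0 // => sum_le0.
have /eqP : \sum_x (v x - wtr rho a x) ^+ 2 == 0.
  by rewrite eq_le sum_le0 sumr_ge0 // => x _; exact: sqr_ge0.
move/psumr_eq0P => eq0; apply/ffunP => x; apply/esym/eqP.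
by rewrite -subr_eq0 -sqrf_eq0 eq0 // => y _; exact: sqr_ge0.
Qed.

End TriangularWeights.

Theorem theorem1 (R : realType) (N : nat) (hN : (0 < N)%N)
    (x0 : R * R) (hx0 : x0 \in grid R N)
    (h : R) (hh : exists2 k : nat, (1 <= k <= N)%N & h = k%:R / N%:R)
    (sigma : R) (hsigma : 0 < sigma)
    (rho : window N x0 h -> R) (hrho : forall x, 0 <= rho x)
    (hrho_neq0 : exists x, rho x <> 0) :
  exists a : R,
    unique (fun t : R => 0 < t /\ M rho t = sigma ^+ 2) a /\
    unique (minimizes_g sigma rho) (wtr rho a).
Proof.
have s0 : 0 < sigma ^+ 2 by rewrite exprn_gt0.
have [a a0 Ma] := M_eq_exists hrho hrho_neq0 s0.
exists a; split; last exact: wtr_unique_minimizer.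
by split=> [//|t [_ Mt]]; exact: M_eq_uniq hrho s0 Ma Mt.
Qed.
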